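(* Let $m\in(0,2)\setminus\{1\}$ and let $(\ell_N)_N$ be integers with $2\le\ell_N\le N$ and $\ell_N\to+\infty$ as $N\to+\infty$. If $\ell_N$ is sufficiently large, then for any $\eta\in\Omega_N$: (i) if $m\in(0,1)$, then $m\,\mathbf{r}^{(0)}(\eta)\le r_N^{(m-1)}(\eta)\le\sum_{k=1}^{\ell_N}\left|\binom{m}{k}\right|k$; (ii) if $m\in(1,2)$, then $m\,\delta_N\,\mathbf{r}^{(0)}(\eta)+\binom{m}{2}\mathbf{r}^{(1)}(\eta)\le r_N^{(m-1)}(\eta)\le m\,\mathbf{r}^{(0)}(\eta)$, where $\delta_N=\sum_{k\ge\ell_N}\left|\binom{m-1}{k}\right|$ satisfies $C_1(\ell_N+1)^{-(m-1)}\le\delta_N\le C_2(\ell_N)^{-(m-1)}$ for some constants $C_1,C_2>0$ independent of $N$. Moreover, when $m\in(0,1)$, $$\sum_{k=1}^{\ell_N}\left|\binom{m}{k}\right|k=\max_{\eta\in\Omega_N}r_N^{(m-1)}(\eta)\xrightarrow[N\to+\infty]{}+\infty.$$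
   Context: $\mathbb{T}_N=\mathbb{Z}/N\mathbb{Z}$, $\Omega_N=\{0,1\}^{\mathbb{T}_N}$; sites are read modulo $N$; $\overline{\eta}(x)=1-\eta(x)$. Put $\mathbf{a}(\eta)=\eta(0)(1-\eta(1))+\eta(1)(1-\eta(0))$. For integers $k\ge0$ and $1\le j\le k+1$, $$\mathbf{s}^{(k)}_j(\eta)=\prod_{\substack{i=-(k+1)+j\\ i\ne0,1}}^{j}\eta(i),\qquad \mathbf{c}^{(k)}(\eta)=\sum_{j=1}^{k+1}\mathbf{s}_j^{(k)}(\eta),\qquad \mathbf{r}^{(k)}(\eta)=\mathbf{c}^{(k)}(\eta)\mathbf{a}(\eta),$$ where the condition $i\ne0,1$ means that the sites $0$ and $1$ of $\mathbb{T}_N$ are excluded (i.e. $i\not\equiv0,1$ modulo $N$); $\mathbf{c}^{(0)}\equiv1$. With $\binom{c}{k}=\frac{c(c-1)\cdots(c-k+1)}{k!}$ for $c\in\mathbb{R}$, $$r_N^{(m-1)}(\eta)=\mathbf{a}(\eta)\sum_{k=1}^{\ell_N}\binom{m}{k}(-1)^{k-1}\mathbf{c}^{(k-1)}(\overline{\eta}).$$ *)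

(* Defs.v *)
From HB Require Import structures.
From mathcomp Require Import all_boot all_order all_algebra.
From mathcomp Require Import all_classical all_reals all_analysis.

Set Implicit Arguments.
Unset Strict Implicit.
Unset Printing Implicit Defensive.

Import Order.TTheory GRing.Theory Num.Theory.
Import numFieldNormedType.Exports.

Local Open Scope classical_set_scope.
Local Open Scope ring_scope.

(* 'Z_N is the discrete torus Z/NZ only for N >= 2 (MathComp identifies 'Z_0
   and 'Z_1 with 'Z_2); every statement below is made for N >= 2. *)
Definition config (N : nat) := {ffun 'Z_N -> bool}.

(* The occupation number of the site x, as an element 0 or 1 of R. *)
Definition occ (R : realType) (N : nat) (eta : config N) (x : 'Z_N) : R :=
  (eta x)%:R.

(* Holes: occ (cbar eta) x = 1 - occ eta x. *)
Definition cbar (N : nat) (eta : config N) : config N := [ffun x => ~~ eta x].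

Definition exclusion (R : realType) (N : nat) (eta : config N) : R :=
  occ R eta 0 * (1 - occ R eta 1) + occ R eta 1 * (1 - occ R eta 0).

(* The site, modulo N, of the integer i = -(k+1) + j + t; it runs through the
   window {-(k+1)+j, ..., j} when t runs through {0, ..., k+1}. *)
Definition window (N k j t : nat) : 'Z_N := - k.+1%:R + j%:R + t%:R.

(* The exclusion of the sites 0 and 1 is tested in Z/NZ, not on the integers;
   this matters when the window wraps around the torus. *)
Definition s_ (R : realType) (N k j : nat) (eta : config N) : R :=
  \prod_(t < k.+2 | (window N k j t != 0) && (window N k j t != 1))
    occ R eta (window N k j t).

Definition c_ (R : realType) (N k : nat) (eta : config N) : R :=
  \sum_(1 <= j < k.+2) s_ R k j eta.

Definition r_ (R : realType) (N k : nat) (eta : config N) : R :=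
  c_ R k eta * exclusion R eta.

(* c(c-1)...(c-k+1) / k! *)
Definition gbinom (R : realType) (c : R) (k : nat) : R :=
  (\prod_(i < k) (c - i%:R)) / k`!%:R.

(* r_N^{(m-1)} with truncation l = ell_N; the parameter is m, not m - 1. *)
Definition rate (R : realType) (N : nat) (m : R) (l : nat) (eta : config N) : R :=
  exclusion R eta *
  \sum_(1 <= k < l.+1) gbinom m k * (-1) ^+ k.-1 * c_ R k.-1 (cbar eta).

Definition ratebound (R : realType) (m : R) (l : nat) : R :=
  \sum_(1 <= k < l.+1) `|gbinom m k| * k%:R.

Definition delta (R : realType) (m : R) (l : nat) : R :=
  \big[+%R/0]_(l <= k <oo) `|gbinom (m - 1) k|.

(* Maximum over the (finite, nonempty) configuration space; the unit of the
   iterated max is the value at the empty configuration. *)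
Definition config_max (R : realType) (N : nat) (F : config N -> R) : R :=
  \big[Num.max/F [ffun=> false]]_(eta : config N) F eta.

(* Main.v *)
Require Import Defs.
From HB Require Import structures.
From mathcomp Require Import all_boot all_order all_algebra.
From mathcomp Require Import all_classical all_reals all_analysis.
From mathcomp Require Import ring lra.

Set Implicit Arguments.
Unset Strict Implicit.
Unset Printing Implicit Defensive.

Import Order.TTheory GRing.Theory Num.Theory.
Import numFieldNormedType.Exports.

Local Open Scope classical_set_scope.
Local Open Scope ring_scope.

(* Write h_k = (-1)^k binom(m-1, k), so that k+1 times the coefficient of
   c^(k) in the rate is m h_k, while 0 <= c^(k) <= k+1 with equality on the
   right when every site other than 0 and 1 is empty.

   If m < 1 all the h_k are nonnegative: keeping only k = 0 gives the lower
   bound, replacing c^(k) by k+1 the upper one, and one particle at 0 attains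
   it; h_k >= (1-m)/k gives the divergence by comparison with the harmonic
   series.

   If m > 1 then h_0 = 1 and h_k <= 0 for k > 0, so the worst case is the empty
   one, for which the sum is m (h_0 + ... + h_(l-1)) = m |binom(m-2, l-1)|.
   Since (1 - 1)^(m-1) = 0 this is m delta, and the loss at k = 1 is exactly
   binom(m, 2) c^(1). With p = m-1, |binom(p-1, n)| = prod_(1 <= i <= n) (1 - p/i)
   is compared with powers of n through the tangent inequality y^p <= 1 + p (y - 1). *)

(** * Generalized binomial coefficients: recurrences and signs *)

Section GeneralizedBinomial.
Variable R : realType.
Implicit Types (c p : R) (k n : nat).

Lemma gbinom0 c : gbinom c 0 = 1.
Proof. by rewrite /gbinom big_ord0 fact0 divr1. Qed.

Lemma gbinomSr c k : gbinom c k.+1 = gbinom c k * (c - k%:R) / k.+1%:R.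
Proof.
have k0 : (k.+1%:R : R) != 0 by rewrite pnatr_eq0.
have f0 : (k`!%:R : R) != 0 by rewrite pnatr_eq0 -lt0n fact_gt0.
rewrite /gbinom big_ord_recr /= factS natrM.
by field; rewrite f0 ?andbT addrC natr1.
Qed.

Lemma mulr_gbinomS c k : gbinom c k.+1 * k.+1%:R = c * gbinom (c - 1) k.
Proof.
have k0 : (k.+1%:R : R) != 0 by rewrite pnatr_eq0.
have f0 : (k`!%:R : R) != 0 by rewrite pnatr_eq0 -lt0n fact_gt0.
rewrite /gbinom big_ord_recl /= subr0 factS natrM.
under eq_bigr => i _ do rewrite /bump /= add1n -(natr1 i) (addrC i%:R) opprD addrA.
by field; rewrite f0 ?andbT addrC natr1.
Qed.

Lemma gbinomS_pascal c k :
  gbinom c k.+1 = gbinom (c - 1) k + gbinom (c - 1) k.+1.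
Proof.
have k0 : (k.+1%:R : R) != 0 by rewrite pnatr_eq0.
apply: (mulIf k0); rewrite mulrDl mulr_gbinomS gbinomSr divfK // -natr1.
by ring.
Qed.

(** By Pascal's rule each summand is a difference of two consecutive values of (-1)^k binom(c-1, k),
    so the sum telescopes. *)
Lemma sum_sign_gbinom c n :
  \sum_(0 <= k < n.+1) (-1) ^+ k * gbinom c k = (-1) ^+ n * gbinom (c - 1) n.
Proof.
elim: n => [|n IHn]; first by rewrite big_nat1 !gbinom0.
by rewrite big_nat_recr //= IHn gbinomS_pascal exprS; ring.
Qed.

(** Consecutive terms have ratio (k - c)/(k + 1), which is nonnegative. *)
Lemma sign_gbinom_ge0 c k : c <= 0 -> 0 <= (-1) ^+ k * gbinom c k.
Proof.
move=> c0; elim: k => [|k IHk]; first by rewrite gbinom0 mulr1.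
have -> : (-1) ^+ k.+1 * gbinom c k.+1 =
    ((-1) ^+ k * gbinom c k) * ((k%:R - c) / k.+1%:R).
  by rewrite gbinomSr exprS; ring.
by rewrite mulr_ge0 // divr_ge0 // subr_ge0 (le_trans c0).
Qed.

Lemma norm_gbinom c k : `|gbinom c k| = `|(-1) ^+ k * gbinom c k|.
Proof. by rewrite normrMsign. Qed.

Lemma norm_gbinomS c k :
  `|gbinom c k.+1| * k.+1%:R = `|c| * `|gbinom (c - 1) k|.
Proof. by rewrite -[k.+1%:R in LHS]ger0_norm // -!normrM mulr_gbinomS. Qed.

(** Absorption ([mulr_gbinomS]) passes to the upper parameter p - 1 <= 0 and costs one sign. *)
Lemma sign_gbinomS_le0 p k : 0 <= p <= 1 -> (-1) ^+ k.+1 * gbinom p k.+1 <= 0.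
Proof.
move=> /andP[p0 p1]; have k0 : 0 < (k.+1%:R : R) by rewrite ltr0n.
rewrite -(pmulr_lle0 _ k0) -mulrA mulr_gbinomS.
have h : 0 <= (-1) ^+ k * gbinom (p - 1) k.
  by apply: sign_gbinom_ge0; rewrite subr_le0.
rewrite exprS mulN1r mulNr oppr_le0 mulrCA.
by rewrite mulr_ge0.
Qed.

Lemma ratebound_sum m l :
  ratebound m l = `|m : R| * \sum_(0 <= k < l) `|gbinom (m - 1) k|.
Proof.
rewrite /ratebound big_add1 /= mulr_sumr.
by apply: eq_bigr => k _; rewrite norm_gbinomS.
Qed.

(** Going from k+1 to k+2 multiplies the modulus by (k+1-c)/(k+2), and k+1-c >= k+1. *)
Lemma norm_gbinomS_ge c k : c <= 0 -> - c / k.+1%:R <= `|gbinom c k.+1|.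
Proof.
move=> c0; elim: k => [|k IHk].
  by rewrite gbinomSr gbinom0 mul1r subr0 !divr1 ler0_norm.
have k1 : 0 < (k.+1%:R : R) by rewrite ltr0n.
have k2 : 0 < (k.+2%:R : R) by rewrite ltr0n.
have k2V : 0 <= (k.+2%:R : R)^-1 by rewrite invr_ge0.
have kc : 0 <= k.+1%:R - c by rewrite subr_ge0 (le_trans c0).
rewrite gbinomSr normrM (normrM (gbinom c _)) (ger0_norm k2V).
rewrite ler_pM2r ?invr_gt0 // distrC (ger0_norm kc).
apply: le_trans (ler_wpM2r kc IHk).
by rewrite mulrAC -mulrA ler_peMr ?oppr_ge0 // ler_pdivlMr // mul1r lerDl oppr_ge0.
Qed.
End GeneralizedBinomial.

(** * Power-law estimates and the closed form of the tail *)

Section TailEstimates.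
Variable R : realType.
Implicit Types (p a b : R) (k n l : nat).

Lemma powR_le_tangent p a b : 0 <= p <= 1 -> 0 < a -> 0 < b ->
  a `^ p <= b `^ p * (1 + p * ((a - b) / b)).
Proof.
move=> /andP[p0 p1] a0 b0; rewrite /powR !gt_eqF //.
set t := ln a - ln b.
have -> : (a - b) / b = expR t - 1.
  by rewrite mulrBl divff ?gt_eqF// /t expRD expRN !lnK.
have -> : p * ln a = p * ln b + p * t by rewrite /t; ring.
rewrite expRD ler_pM2l ?expR_gt0 //.
have h0 : 0 < expR (p * t) by exact: expR_gt0.
have h1 : expR (p * t) * expR (- (p * t)) = 1 by rewrite -expRD subrr expR0.
have h2 : expR (p * t) * expR ((1 - p) * t) = expR t.
  by rewrite -expRD; congr expR; ring.
(* With a/b = e^t the claim is e^(pt) <= p e^t + 1 - p. Use e^x >= 1 + x at -pt and at (1-p)t, with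
   weights 1-p and p: the terms linear in t cancel. *)
have h3 := expR_ge1Dx (- (p * t)).
have h4 := expR_ge1Dx ((1 - p) * t).
have h5 : expR (p * t) * (1 + - (p * t)) <= 1 by rewrite -[leRHS]h1 ler_pM2l.
have h6 : expR (p * t) * (1 + (1 - p) * t) <= expR t by rewrite -[leRHS]h2 ler_pM2l.
have h7 := ler_wpM2l p0 h6.
have q0 : 0 <= 1 - p by rewrite subr_ge0.
have h8 := ler_wpM2l q0 h5.
lra.
Qed.

Lemma norm_gbinomB1S p n : p <= 1 ->
  `|gbinom (p - 1) n.+1| = `|gbinom (p - 1) n| * (1 - p / n.+1%:R).
Proof.
move=> p1; have n1 : 0 < (n.+1%:R : R) by rewrite ltr0n.
have h : 0 <= 1 - p / n.+1%:R.
  by rewrite subr_ge0 ler_pdivrMr // mul1r (le_trans p1) // ler1n.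
rewrite -[in RHS](ger0_norm h) -normrM gbinomSr -normrN; congr `|_|.
by field; rewrite addrC natr1 gt_eqF.
Qed.

Lemma norm_gbinomB1_le p n : 0 <= p <= 1 ->
  `|gbinom (p - 1) n| <= n.+1%:R `^ (- p).
Proof.
move=> p01; have /andP[p0 p1] := p01.
elim: n => [|n IHn]; first by rewrite gbinom0 normr1 powR1.
have n1 : 0 < (n.+1%:R : R) by rewrite ltr0n.
have n2 : 0 < (n.+2%:R : R) by rewrite ltr0n.
have h0 : 0 <= 1 - p / n.+1%:R.
  by rewrite subr_ge0 ler_pdivrMr // mul1r (le_trans p1) // ler1n.
rewrite norm_gbinomB1S //; apply: le_trans (ler_wpM2r h0 IHn) _.
rewrite !powRN mulrC ler_pdivrMr ?powR_gt0 // [leRHS]mulrC ler_pdivlMr ?powR_gt0 //.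
have := powR_le_tangent p01 n2 n1.
have -> : (n.+2%:R - n.+1%:R : R) / n.+1%:R = n.+1%:R^-1.
  by rewrite -natrB // subSnn mul1r.
move=> h; rewrite mulrC; apply: le_trans (ler_wpM2r h0 h) _.
rewrite -mulrA ler_piMr ?powR_ge0 //.
(* What remains is (1 - x)(1 + x) <= 1 for x = p/(n+1). *)
have : 0 <= (p / n.+1%:R) ^+ 2 by apply: sqr_ge0.
set x := n.+1%:R^-1; rewrite expr2; nra.
Qed.

(** The constant 1 - p is the value at n = 0; the induction step is exactly the tangent inequality
    at y = (n+1)/(n+2). *)
Lemma norm_gbinomB1_ge p n : 0 <= p <= 1 ->
  (1 - p) * n.+1%:R `^ (- p) <= `|gbinom (p - 1) n.+1|.
Proof.
move=> p01; have /andP[p0 p1] := p01.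
elim: n => [|n IHn].
  by rewrite norm_gbinomB1S // gbinom0 normr1 powR1 mul1r mulr1 divr1.
have n1 : 0 < (n.+1%:R : R) by rewrite ltr0n.
have n2 : 0 < (n.+2%:R : R) by rewrite ltr0n.
have h0 : 0 <= 1 - p / n.+2%:R.
  by rewrite subr_ge0 ler_pdivrMr // mul1r (le_trans p1) // ler1n.
rewrite norm_gbinomB1S //; apply: le_trans _ (ler_wpM2r h0 IHn).
rewrite -mulrA ler_wpM2l ?subr_ge0 //.
rewrite !powRN [leRHS]mulrC ler_pdivlMr ?powR_gt0 // mulrC ler_pdivrMr ?powR_gt0 //.
have := powR_le_tangent p01 n1 n2.
have -> : (n.+1%:R - n.+2%:R : R) / n.+2%:R = - n.+2%:R^-1.
  by rewrite -opprB -natrB // subSnn mulN1r.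
by rewrite mulrN mulrC.
Qed.

Lemma cvg_powRN_succn p : 0 < p -> n.+1%:R `^ (- p) @[n --> \oo] --> (0 : R).
Proof.
move=> p0.
(* [powR_cvg0] is a limit from the right at 0, so 1/(n+1) must be seen to stay positive. *)
have harm : harmonic @ \oo --> (0 : R)^'+.
  move=> P /= hP; have := @cvg_harmonic R _ hP.
  by apply: (@filterS nat \oo _ _ (harmonic @^-1` P)) => n; apply; exact: harmonic_gt0.
have := cvg_comp _ _ harm (powR_cvg0 p0).
apply: cvg_trans; apply: near_eq_cvg; near=> n => /=.
by rewrite /harmonic -powR_inv1 // -powRrM mulN1r.
Unshelve. all: by end_near. Qed.

(** By [sum_sign_gbinom], |binom(p-1, q)| is the partial sum up to q of (-1)^k binom(p, k), whose
    terms are nonpositive from k = 1 on; hence the reversed order of the difference. *)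
Lemma sum_norm_gbinom p l n : 0 <= p <= 1 -> (l <= n)%N ->
  \sum_(l.+1 <= k < n.+1) `|gbinom p k| =
  `|gbinom (p - 1) l| - `|gbinom (p - 1) n|.
Proof.
move=> p01 ln; have /andP[p0 p1] := p01.
have E q : `|gbinom (p - 1) q| = \sum_(0 <= k < q.+1) (-1) ^+ k * gbinom p k.
  by rewrite sum_sign_gbinom norm_gbinom ger0_norm // sign_gbinom_ge0 // subr_le0.
rewrite (E l) (E n) (@big_cat_nat _ _ _ l.+1 0 n.+1) //= opprD addrA subrr sub0r.
rewrite -sumrN; apply: eq_big_nat => -[|k] // _.
by rewrite norm_gbinom ler0_norm // sign_gbinomS_le0.
Qed.

(* The partial sums of (1 - 1)^p have the closed form (-1)^n binom(p-1, n), so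
   the tail telescopes. *)
Lemma deltaE m l : 1 < m <= 2 -> delta m l.+1 = `|gbinom (m - 2) l : R|.
Proof.
move=> /andP[m1 m2]; set p : R := m - 1.
have p0 : 0 < p by rewrite subr_gt0.
have p01 : 0 <= p <= 1 by rewrite ltW //= /p; lra.
have -> : m - 2 = p - 1 by rewrite /p; ring.
have H0 : `|gbinom (p - 1) n| @[n --> \oo] --> (0 : R).
  apply: (@squeeze_cvgr _ _ _ _ (fun=> 0) (fun n => n.+1%:R `^ (- p))).
  - by apply: nearW => n; rewrite normr_ge0 norm_gbinomB1_le.
  - exact: cvg_cst.
  - exact: cvg_powRN_succn.
apply: cvg_lim => //; rewrite -cvg_shiftS.
have H : `|gbinom (p - 1) l| - `|gbinom (p - 1) n| @[n --> \oo]
    --> (`|gbinom (p - 1) l| : R).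
  rewrite -[X in _ --> X]subr0; apply: cvgB => //; exact: cvg_cst.
apply: cvg_trans H; apply: near_eq_cvg; near=> n.
rewrite /mk_sequence /= -/p sum_norm_gbinom //; near: n; exact: nbhs_infty_ge.
Unshelve. all: by end_near. Qed.

End TailEstimates.

(** * Bounds on the constraints and the extremal configuration *)

Section ConstraintBounds.
Variables (R : realType) (N : nat).
Implicit Types (eta : config N) (k j : nat).

Lemma s__ge0 k j eta : 0 <= s_ R k j eta.
Proof. by apply: prodr_ge0 => t _; rewrite /occ ler0n. Qed.

Lemma s__le1 k j eta : s_ R k j eta <= 1.
Proof. by apply: prodr_ile1 => t _; rewrite /occ ler0n lern1 leq_b1. Qed.

Lemma c__ge0 k eta : 0 <= c_ R k eta.
Proof. by apply: sumr_ge0 => j _; exact: s__ge0. Qed.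

Lemma c__le k eta : c_ R k eta <= k.+1%:R.
Proof.
apply: (@le_trans _ _ (\sum_(1 <= j < k.+2) 1)).
  by apply: ler_sum => j _; exact: s__le1.
by rewrite sumr_const_nat subSS subn0.
Qed.

(** For k = 0 the only window is {0, 1}, so the product is empty. *)
Lemma c_0 eta : c_ R 0 eta = 1.
Proof.
rewrite /c_ big_nat1 /s_ big_pred0 // => -[[|[|//]] ti] /=.
  by rewrite /window addNr add0r eqxx.
by rewrite /window addNr add0r eqxx andbF.
Qed.

Lemma r_0 eta : r_ R 0 eta = exclusion R eta.
Proof. by rewrite /r_ c_0 mul1r. Qed.

Lemma exclusion_eq eta : exclusion R eta = (eta 0 != eta 1)%:R.
Proof.
rewrite /exclusion /occ; case: (eta 0); case: (eta 1) => /=;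
  by rewrite ?subrr ?subr0 ?mulr0 ?mul0r ?mulr1 ?addr0 ?add0r.
Qed.

Lemma exclusion_ge0 eta : 0 <= exclusion R eta.
Proof. by rewrite exclusion_eq. Qed.

Lemma exclusion_le1 eta : exclusion R eta <= 1.
Proof. by rewrite exclusion_eq lern1 leq_b1. Qed.

Definition one_particle : config N := [ffun x => x == 0].

Lemma exclusion_one_particle : exclusion R one_particle = 1.
Proof. by rewrite exclusion_eq !ffunE eqxx oner_eq0. Qed.

(** The only particle sits at the excluded site 0, so every factor is 1, even when a window wraps
    around the torus. *)
Lemma c__one_particle k : c_ R k (cbar one_particle) = k.+1%:R.
Proof.
rewrite /c_ (eq_bigr (fun=> 1)); first by rewrite sumr_const_nat subSS subn0.
by move=> j _; rewrite /s_ big1 // => t /andP[t0 _]; rewrite /occ !ffunE t0.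
Qed.

Lemma rateE (m : R) l eta : rate m l eta = exclusion R eta *
  \sum_(0 <= k < l) gbinom m k.+1 * (-1) ^+ k * c_ R k (cbar eta).
Proof. by rewrite /rate big_add1. Qed.

End ConstraintBounds.

(* For N = 2 the sites -1 and 2 coincide with 1 and 0, so that c^(1) = 2. *)
Lemma c_1_cbar (R : realType) N (eta : config N) : (3 <= N)%N ->
  c_ R 1 (cbar eta) = 2 - c_ R 1 eta.
Proof.
case: N eta => [|[|[|n]]] // eta _.
have neq20 : (2 : 'Z_n.+3) != 0 by [].
have neq21 : (2 : 'Z_n.+3) != 1 by [].
have neqN10 : (-1 : 'Z_n.+3) != 0 by rewrite oppr_eq0 oner_eq0.
have neqN11 : (-1 : 'Z_n.+3) != 1 by rewrite eq_sym -addr_eq0.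
(* The windows {-1, 0, 1} and {0, 1, 2} keep one site each; for N = 3 it is the same site, counted
   twice. *)
have E (xi : config n.+3) : c_ R 1 xi = occ R xi (-1) + occ R xi 2.
  rewrite /c_ big_nat_recr //= big_nat1; congr (_ + _).
    rewrite /s_ big_mkcond !big_ord_recl big_ord0 /=.
    have -> : window n.+3 1 1 0 = -1 by rewrite /window /bump /=; ring.
    have -> : window n.+3 1 1 (bump 0 0) = 0 by rewrite /window /bump /=; ring.
    have -> : window n.+3 1 1 (bump 0 (bump 0 0)) = 1 by rewrite /window /bump /=; ring.
    by rewrite neqN10 neqN11 !eqxx /= !mulr1.
  rewrite /s_ big_mkcond !big_ord_recl big_ord0 /=.
  have -> : window n.+3 1 2 0 = 0 by rewrite /window /bump /=; ring.
  have -> : window n.+3 1 2 (bump 0 0) = 1 by rewrite /window /bump /=; ring.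
  have -> : window n.+3 1 2 (bump 0 (bump 0 0)) = 2 by rewrite /window /bump /=; ring.
  by rewrite neq20 ?neq21 !eqxx /= !mul1r mulr1.
rewrite !E /occ !ffunE; case: (eta _); case: (eta _) => /=; ring.
Qed.

(** * Bounds on the rate, its maximum, and the size of delta *)

Section RateBounds.
Variable R : realType.
Implicit Types (m : R) (N l : nat).

Lemma rate_bounds_lt1 N m l (eta : config N) : 0 < m < 1 -> (0 < l)%N ->
  m * r_ R 0 eta <= rate m l eta <= ratebound m l.
Proof.
move=> /andP[m0 m1] l0; have m01 : 0 <= m <= 1 by rewrite !ltW.
have g0 k : 0 <= gbinom m k.+1 * (-1) ^+ k.
  by have := sign_gbinomS_le0 k m01; rewrite exprS mulN1r mulNr oppr_le0 mulrC.
have t0 k : 0 <= gbinom m k.+1 * (-1) ^+ k * c_ R k (cbar eta).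
  by rewrite mulr_ge0 ?c__ge0.
rewrite rateE r_0; apply/andP; split.
  case: l l0 => // l _.
  rewrite mulrC ler_wpM2l ?exclusion_ge0 // big_nat_recl //.
  by rewrite gbinomSr gbinom0 c_0 mul1r subr0 divr1 !mulr1 lerDl sumr_ge0.
apply: le_trans (ler_piMl _ (exclusion_le1 R eta)) _; first exact: sumr_ge0.
rewrite /ratebound big_add1; apply: ler_sum => k _.
have -> : `|gbinom m k.+1| = gbinom m k.+1 * (-1) ^+ k.
  by rewrite -(normrMsign k) mulrC ger0_norm.
by rewrite ler_wpM2l // c__le.
Qed.

Lemma rate_one_particle N m l : 0 < m < 1 ->
  rate m l (one_particle N) = ratebound m l.
Proof.
move=> /andP[m0 m1]; have m01 : 0 <= m <= 1 by rewrite !ltW.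
rewrite rateE exclusion_one_particle mul1r /ratebound big_add1.
apply: eq_bigr => k _; rewrite c__one_particle norm_gbinom ler0_norm.
  by rewrite exprS mulN1r mulNr opprK [in RHS]mulrC [in RHS](mulrC (_ ^+ _)) mulrC.
exact: sign_gbinomS_le0.
Qed.

Lemma config_max_rate N m l : 0 < m < 1 -> (0 < l)%N ->
  config_max (rate (N := N) m l) = ratebound m l.
Proof.
move=> m01 l0.
have bound (eta : config N) : rate m l eta <= ratebound m l.
  by have /andP[] := rate_bounds_lt1 eta m01 l0.
apply/eqP; rewrite eq_le; apply/andP; split; first exact: bigmax_le.
by rewrite -(rate_one_particle N l m01); exact: le_bigmax.
Qed.

(** Discarding the k = 0 term of [ratebound_sum] accounts for the shift from l to l+1. *)
Lemma ratebound_ge_harmonic m l : 0 < m < 1 ->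
  m * (1 - m) * series harmonic l <= ratebound m l.+1.
Proof.
move=> /andP[m0 m1].
rewrite ratebound_sum gtr0_norm // -mulrA ler_pM2l // big_nat_recl //.
rewrite -[leLHS]add0r lerD // /series /= mulr_sumr.
apply: ler_sum => k _; have := @norm_gbinomS_ge R (m - 1) k.
by rewrite opprB; apply; rewrite subr_le0 ltW.
Qed.

Lemma ratebound_cvgy m : 0 < m < 1 -> ratebound m l @[l --> \oo] --> +oo.
Proof.
move=> /[dup] m01 /andP[m0 m1]; rewrite -cvg_shiftS; apply/cvgryPge => A.
have c0 : 0 < m * (1 - m) by rewrite mulr_gt0 // subr_gt0.
have ndh : nondecreasing_seq (series (@harmonic R)).
  by apply: nondecreasing_series => n _ _; exact: harmonic_ge0.
have /cvgryPge/(_ (A / (m * (1 - m))))[n _ hn] :=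
  nondecreasing_dvgn_lt ndh (@dvg_harmonic R).
near=> l; apply: le_trans (ratebound_ge_harmonic l m01).
by rewrite mulrC -ler_pdivrMr //; apply: hn; near: l; exact: nbhs_infty_ge.
Unshelve. all: by end_near. Qed.

Lemma rate_bounds_gt1 N m l (eta : config N) : 1 < m < 2 ->
  (3 <= l <= N)%N ->
  m * delta m l * r_ R 0 eta + gbinom m 2 * r_ R 1 eta
    <= rate m l eta <= m * r_ R 0 eta.
Proof.
move=> /andP[m1 m2] /andP[l3 lN].
have m0 : 0 < m by exact: lt_trans m1.
have p01 : 0 <= m - 1 <= 1 by apply/andP; split; lra.
have gS k : gbinom m k.+1 * (-1) ^+ k * k.+1%:R =
    m * ((-1) ^+ k * gbinom (m - 1) k).
  by rewrite mulrAC mulr_gbinomS; ring.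
have g0 k : gbinom m k.+2 * (-1) ^+ k.+1 <= 0.
  have k0 : 0 < (k.+2%:R : R) by rewrite ltr0n.
  by rewrite -(pmulr_lle0 _ k0) gS pmulr_rle0 // sign_gbinomS_le0.
have gb1 : gbinom m 1 = m by rewrite gbinomSr gbinom0 mul1r subr0 divr1.
rewrite rateE r_0 /r_; apply/andP; split; last first.
  rewrite [leRHS]mulrC ler_wpM2l ?exclusion_ge0 //.
  case: l l3 lN => // l _ _; rewrite big_nat_recl // c_0 gb1 !mulr1 gerDl.
  by apply: sumr_le0 => k _; rewrite mulr_le0_ge0 ?g0 ?c__ge0.
rewrite mulrA -mulrDl [leLHS]mulrC ler_wpM2l ?exclusion_ge0 //.
(* This writes m delta as the sum in the rate with each c^(k) replaced by its maximum k+1, so both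
   sides compare term by term. *)
have -> : m * delta m l =
    \sum_(0 <= k < l) gbinom m k.+1 * (-1) ^+ k * k.+1%:R.
  case: l l3 lN => // l _ _; rewrite deltaE ?m1 ?(ltW m2) //.
  under eq_bigr => k _ do rewrite gS.
  have -> : m - 2 = m - 1 - 1 by ring.
  rewrite -mulr_sumr sum_sign_gbinom norm_gbinom ger0_norm //.
  by apply: sign_gbinom_ge0; lra.
case: l l3 lN => [|[|l]] // l3 lN.
(* The terms k = 0 and k = 1 agree on both sides; the later ones have nonpositive coefficients and
   c^(k) <= k+1. The formula for c^(1) of the holes requires N >= 3, obtained from 3 <= l <= N. *)
rewrite !big_nat_recl // !addrA c_0 c_1_cbar; last exact: leq_trans lN.
rewrite [leLHS]addrAC lerD //; first by rewrite expr1 expr0; lra.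
apply: ler_sum => k _; rewrite ler_wnM2l ?g0 // c__le //.
Qed.

(** With p = m - 1, delta is |binom(p-1, l-1)|. The product estimates give the upper bound directly
    and a lower bound in (l-1)^(-p), which is then weakened to (l+1)^(-p). *)
Lemma delta_bounds m l : 1 < m < 2 -> (2 <= l)%N ->
  (2 - m) * l.+1%:R `^ (- (m - 1)) <= delta m l <= l%:R `^ (- (m - 1)).
Proof.
move=> /andP[m1 m2]; have p01 : 0 <= m - 1 <= 1 by apply/andP; split; lra.
have -> : 2 - m = 1 - (m - 1) by ring.
case: l => [|[|l]] // _; rewrite deltaE ?m1 ?(ltW m2) //.
have -> : m - 2 = m - 1 - 1 by ring.
rewrite norm_gbinomB1_le // andbT; apply: le_trans (norm_gbinomB1_ge l p01).
rewrite ler_wpM2l //; first by lra.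
rewrite !powRN lef_pV2 ?posrE ?powR_gt0 // ge0_ler_powR ?nnegrE //; first by lra.
by rewrite ler_nat leqW.
Qed.

End RateBounds.
Theorem proposition2p11 (R : realType) (m : R) (hm : 0 < m < 2) (hm1 : m != 1)
    (ell : nat -> nat)
    (hell : forall N : nat, (2 <= N)%N -> (2 <= ell N <= N)%N)
    (hell_oo : ell N @[N --> \oo] --> \oo) :
  (exists L : nat,
    (m < 1 ->
      forall N : nat, (2 <= N)%N -> (L <= ell N)%N ->
      forall eta : config N,
        m * r_ R 0 eta <= rate m (ell N) eta <= ratebound m (ell N))
    /\
    (1 < m ->
      (forall N : nat, (2 <= N)%N -> (L <= ell N)%N ->
       forall eta : config N,
        m * delta m (ell N) * r_ R 0 eta + gbinom m 2 * r_ R 1 eta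
          <= rate m (ell N) eta <= m * r_ R 0 eta)
      /\
      (exists C1 C2 : R, [/\ 0 < C1, 0 < C2 &
        forall N : nat, (2 <= N)%N -> (L <= ell N)%N ->
          C1 * (ell N).+1%:R `^ (- (m - 1)) <= delta m (ell N)
            <= C2 * (ell N)%:R `^ (- (m - 1))])))
  /\
  (m < 1 ->
    (forall N : nat, (2 <= N)%N ->
      ratebound m (ell N) = config_max (rate (N := N) m (ell N)))
    /\ (ratebound m (ell N) @[N --> \oo] --> +oo)).
Proof.
have /andP[m0 m2] := hm.
split.
  (* Since [ell N <= N], the threshold 3 rules out N = 2, where c^(1) degenerates. *)
  exists 3%N; split=> m1.
    move=> N N2 _ eta; apply: rate_bounds_lt1; first by rewrite m0.
    by have /andP[/ltnW] := hell N N2.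
  split=> [N N2 L eta|].
    by apply: rate_bounds_gt1; rewrite ?m1 // L; have /andP[] := hell N N2.
  exists (2 - m), 1; split=> //; first by rewrite subr_gt0.
  move=> N N2 _; rewrite mul1r; apply: delta_bounds; first by rewrite m1.
  by have /andP[] := hell N N2.
move=> m1; have m01 : 0 < m < 1 by rewrite m0.
split; last exact: cvg_comp hell_oo (ratebound_cvgy m01).
move=> N N2; rewrite config_max_rate //.
by have /andP[/ltnW] := hell N N2.
Qed.
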